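(* Let $$\begin{aligned}\varphi_{12}^{\pm}(x,y)={}&x^{12}-(462\pm264\sqrt3)x^{10}y^2+(48015\pm27720\sqrt3)x^8y^4-(1248324\pm720720\sqrt3)x^6y^6\\&+(9314415\pm5377680\sqrt3)x^4y^8-(17297742\pm9986856\sqrt3)x^2y^{10}+(3650401\pm2107560\sqrt3)y^{12},\end{aligned}$$ regarded as formal weight enumerators for $q=8\pm4\sqrt3$ (corresponding signs). Then: (i) The extremal formal weight enumerator $\varphi_{12}^{+}(x,y)$ (with $q=8+4\sqrt3$) does not satisfy the Riemann hypothesis. (ii) The extremal formal weight enumerator $\varphi_{12}^{-}(x,y)$ (with $q=8-4\sqrt3$) satisfies the Riemann hypothesis.
   Context: For a matrix $\sigma=\begin{pmatrix} a&b\\ c&e\end{pmatrix}$ and $f\in\mathbf{C}[x,y]$ put $f^\sigma(x,y)=f(ax+by,cx+ey)$; for real $q>0$, $q\ne1$, let $\sigma_q=\frac{1}{\sqrt q}\begin{pmatrix}1&q-1\\1&-1\end{pmatrix}$. A formal weight enumerator for $q$ is a homogeneous polynomial $W(x,y)=x^n+\sum_{i=d}^nA_ix^{n-i}y^i\in\mathbf{C}[x,y]$ with $A_d\ne0$ and $W^{\sigma_q}=-W$. It is divisible by $c\in\mathbf{N}$ if $A_i\neq0$ implies $c\mid i$. For fixed $q,c,n$, a formal weight enumerator for $q$ of degree $n$ divisible by $c$ is called extremal if its $d$ is maximal among all formal weight enumerators for $q$ of degree $n$ divisible by $c$. Here $c=2$, $n=12$, and $\varphi_{12}^\pm$ (which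 have $d=2$) are extremal formal weight enumerators for $q=8\pm4\sqrt3$. Zeta polynomial: for $W(x,y)=x^n+\sum_{i=d}^nA_ix^{n-i}y^i$ with $A_d\ne0$ (here $d\ge2$) and real $q>0$, $q\neq1$, the zeta polynomial of $W$ is the unique $P(T)\in\mathbf{C}[T]$ of degree at most $n-d$ such that, expanding in powers of $T$, the coefficient of $T^{n-d}$ in $$\frac{P(T)}{(1-T)(1-qT)}\,(y(1-T)+xT)^n$$ equals $\dfrac{W(x,y)-x^n}{q-1}$. Riemann hypothesis: $W$ with $W^{\sigma_q}=\pm W$ satisfies the Riemann hypothesis if all zeros of its zeta polynomial $P(T)$ in $\mathbf{C}$ have absolute value $1/\sqrt q$. *)

(* Defs.v *)
From HB Require Import structures.
From mathcomp Require Import all_boot all_order all_algebra.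
From mathcomp Require Import complex mpoly.
From mathcomp Require Import boolp classical_sets reals.

Set Implicit Arguments.
Unset Strict Implicit.
Unset Printing Implicit Defensive.

Import Order.TTheory GRing.Theory Num.Theory.
Local Open Scope ring_scope.
Local Open Scope complex_scope.

Section PowerSeries.
Variable A : comNzRingType.
Implicit Types (f g : nat -> A) (a : A).

(* A formal power series in T over A is its sequence of coefficients. *)
Definition fps_mul f g : nat -> A := fun k => \sum_(i < k.+1) f i * g (k - i)%N.
Definition fps_of_poly (p : {poly A}) : nat -> A := fun k => p`_k.

(* The expansion of 1 / (1 - a T); see fps_geomK. *)
Definition fps_geom a : nat -> A := fun k => a ^+ k.

Lemma fps_mul_geom0 f a : fps_mul f (fps_geom a) 0%N = f 0%N.
Proof. by rewrite /fps_mul big_ord1 /fps_geom expr0 mulr1. Qed.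

Lemma fps_mul_geomS f a k :
  fps_mul f (fps_geom a) k.+1 = f k.+1 + a * fps_mul f (fps_geom a) k.
Proof.
rewrite /fps_mul big_ord_recr /= subnn /fps_geom expr0 mulr1 addrC mulr_sumr.
congr (_ + _); apply: eq_bigr => i _ /=.
have leik : (i <= k)%N by rewrite -ltnS ltn_ord.
by rewrite subSn // exprS mulrCA.
Qed.

Lemma fps_geomK a k :
  fps_mul (fps_of_poly (1 - a%:P * 'X)) (fps_geom a) k = (k == 0%N)%:R.
Proof.
elim: k => [|k IHk].
  by rewrite fps_mul_geom0 /fps_of_poly coefB coef1 coefMX subr0.
rewrite fps_mul_geomS {}IHk /fps_of_poly coefB coef1 coefMX coefC sub0r /=.
by case: k => [|k] /=; rewrite ?mulr1 ?mulr0 ?addNr // oppr0 addr0.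
Qed.

Lemma fps_geom_surj a (g : nat -> A) :
  exists f, forall k, fps_mul f (fps_geom a) k = g k.
Proof.
exists (fun k => if k is j.+1 then g j.+1 - a * g j else g 0%N).
elim=> [|k IHk]; first by rewrite fps_mul_geom0.
by rewrite fps_mul_geomS IHk subrK.
Qed.

Lemma fps_geom_inj a f g m :
  (forall k, (k <= m)%N ->
     fps_mul f (fps_geom a) k = fps_mul g (fps_geom a) k) ->
  forall k, (k <= m)%N -> f k = g k.
Proof.
move=> fg [|k] lekm; first by have := fg _ lekm; rewrite !fps_mul_geom0.
have := fg _ lekm; rewrite !fps_mul_geomS fg; last exact: ltnW.
exact: addIr.
Qed.

Lemma eq_fps_mul f f' g m :
  (forall k, (k <= m)%N -> f k = f' k) ->
  forall k, (k <= m)%N -> fps_mul f g k = fps_mul f' g k.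
Proof.
move=> ff k lekm; apply: eq_bigr => i _; rewrite ff //.
by rewrite (leq_trans _ lekm) // -ltnS ltn_ord.
Qed.

End PowerSeries.

Section FormalWeightEnumerators.
Variable R : realType.
Local Notation C := R[i].
Implicit Types (q : R) (n d c : nat) (W : {mpoly C[2]}).

(* C = R[i]; the variables of C[x,y] are x = 'X_0 and y = 'X_1. *)
Definition Xvar : {mpoly C[2]} := 'X_0.
Definition Yvar : {mpoly C[2]} := 'X_1.

(* f^sigma(x,y) = f(a x + b y, c x + e y) *)
Definition mx_act (f : {mpoly C[2]}) (sigma : 'M[C]_2) : {mpoly C[2]} :=
  f \mPo [tuple sigma i 0 *: Xvar + sigma i 1 *: Yvar | i < 2].

Definition sigma_mx q : 'M[C]_2 :=
  ((Num.sqrt q)^-1)%:C *: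
    \matrix_(i < 2, j < 2)
      (if i == 0 then if j == 0 then 1 else q%:C - 1
       else if j == 0 then 1 else -1).

Definition weight_poly n d (A : nat -> C) : {mpoly C[2]} :=
  Xvar ^+ n + \sum_(d <= i < n.+1) A i *: (Xvar ^+ (n - i) * Yvar ^+ i).

Definition formal_weight_enumerator q n d W : Prop :=
  [/\ 0 < q /\ q != 1, (0 < d <= n)%N,
      exists2 A : nat -> C, A d != 0 & W = weight_poly n d A
    & mx_act W (sigma_mx q) = - W].

(* The exponent of y in the monomial m is m 1. *)
Definition divisible_by c W : Prop :=
  forall m : 'X_{1..2}, W@_m != 0 -> (c %| m 1%R)%N.

Definition extremal_fwe q c n d W : Prop :=
  [/\ formal_weight_enumerator q n d W, divisible_by c W
    & forall d' W', formal_weight_enumerator q n d' W' ->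
        divisible_by c W' -> (d' <= d)%N].

(* P is viewed in C[x,y][T] through the embedding of C in C[x,y]. *)
Definition zeta_series q n (P : {poly C}) : nat -> {mpoly C[2]} :=
  fps_mul
    (fps_mul (fps_mul (fps_of_poly (map_poly (@mpolyC 2 C) P)) (fps_geom 1))
             (fps_geom (q%:C)%:MP))
    (fps_of_poly ((Yvar%:P * (1 - 'X) + Xvar%:P * 'X) ^+ n)).

Definition is_zeta_polynomial q n d W (P : {poly C}) : Prop :=
  (size P <= (n - d).+1)%N /\
  zeta_series q n P (n - d)%N = (q%:C - 1)^-1 *: (W - Xvar ^+ n).

(* The zeta polynomial; it exists and is unique by zeta_polynomial_unique,
   so that the default value 0 of xget plays no role. *)
Definition zeta_polynomial q n d W : {poly C} :=
  xget 0 [set P | is_zeta_polynomial q n d W P]%classic.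

Definition scalar_series q (P : {poly C}) : nat -> C :=
  fps_mul (fps_mul (fps_of_poly P) (fps_geom 1)) (fps_geom q%:C).

Lemma zeta_seriesE q n d P : (d <= n)%N ->
  zeta_series q n P (n - d)%N =
  \sum_(k < (n - d).+1)
    (scalar_series q P k *+ 'C(n, n - d - k)) *:
       (Yvar ^+ (d + k) * (Xvar - Yvar) ^+ (n - d - k)).
Proof.
move=> ledn; apply: eq_bigr => k _.
have lek : (k <= n - d)%N by rewrite -ltnS ltn_ord.
have -> : fps_mul (fps_mul (fps_of_poly (map_poly (@mpolyC 2 C) P))
                    (fps_geom 1))
           (fps_geom (q%:C)%:MP) k = (scalar_series q P k)%:MP.
  rewrite /scalar_series /fps_mul rmorph_sum /=; apply: eq_bigr => i _.
  rewrite rmorphM rmorph_sum /= /fps_geom rmorphXn /=; congr (_ * _).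
  apply: eq_bigr => j _; rewrite /fps_of_poly coef_map /= rmorphM /=.
  by rewrite !expr1n rmorph1.
rewrite mul_mpolyC -scalerMnl scalerMnr; congr (_ *: _).
have lem : (n - d - k < n.+1)%N by rewrite ltnS -subnDA leq_subr.
have -> : Yvar%:P * (1 - 'X) + Xvar%:P * 'X
   = Yvar%:P + (Xvar - Yvar)%:P * 'X :> {poly {mpoly C[2]}}.
  by rewrite polyCB mulrBl mulrBr mulr1 -addrA (addrC (- _)).
rewrite /fps_of_poly exprDn coef_sum (bigD1 (Ordinal lem)) //= big1 ?addr0.
  rewrite coefMn exprMn mulrA -!rmorphXn /= -polyCM coefCM coefXn eqxx mulr1.
  congr (_ ^+ _ * _ *+ _).
  by rewrite -subnDA subKn // -leq_subRL.
move=> i nei; rewrite coefMn exprMn mulrA -!rmorphXn /= -polyCM coefCM coefXn.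
by rewrite eq_sym -val_eqE /= in nei *; rewrite (negPf nei) mulr0 mul0rn.
Qed.

Lemma YX_inj m d (e : nat -> C) :
  \sum_(k < m.+1) e k *: (Yvar ^+ (d + k) * (Xvar - Yvar) ^+ (m - k)) = 0 ->
  forall k, (k <= m)%N -> e k = 0.
Proof.
pose h (i : 'I_2) : {poly C} := if i == 0 then 1 + 'X else 'X.
move=> /(congr1 (mmap (@polyC C) h)); rewrite rmorph_sum rmorph0 /=.
have mX : mmap (@polyC C) h Xvar = 1 + 'X by rewrite mmapX mmap1U.
have mY : mmap (@polyC C) h Yvar = 'X by rewrite mmapX mmap1U.
move=> e0 k lekm; have := congr1 (coefp (d + k)) e0.
rewrite /= coef0 coef_sum.
have lek : (k < m.+1)%N by [].
rewrite (bigD1 (Ordinal lek)) //= big1 => [|i nei];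
  rewrite mmapZ rmorphM !rmorphXn rmorphB /= mX mY addrK expr1n mulr1;
  rewrite coefCM coefXn.
  by rewrite eqxx mulr1 addr0.
by rewrite eqn_add2l eq_sym; rewrite -val_eqE /= in nei;
  rewrite (negPf nei) mulr0.
Qed.

Lemma YX_span m d (A : nat -> C) : exists e : nat -> C,
  \sum_(k < m.+1) e k *: (Yvar ^+ (d + k) * (Xvar - Yvar) ^+ (m - k)) =
  \sum_(k < m.+1) A k *: (Yvar ^+ (d + k) * Xvar ^+ (m - k)).
Proof.
pose S f := exists e : nat -> C, f =
  \sum_(k < m.+1) e k *: (Yvar ^+ (d + k) * (Xvar - Yvar) ^+ (m - k)).
have S0 : S 0 by exists (fun=> 0); rewrite big1 // => i _; rewrite scale0r.
have SD f g : S f -> S g -> S (f + g).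
  move=> [e ->] [e' ->]; exists (fun k => e k + e' k).
  by rewrite -big_split; apply: eq_bigr => i _; rewrite scalerDl.
have SZ a f : S f -> S (a *: f).
  move=> [e ->]; exists (fun k => a * e k).
  by rewrite scaler_sumr; apply: eq_bigr => i _; rewrite scalerA.
have Sgen i k : (i + k <= m)%N ->
    S (Yvar ^+ (d + k) * Xvar ^+ i * (Xvar - Yvar) ^+ (m - k - i)).
  elim: i k => [|i IHi] k lem.
    exists (fun j => (j == k)%:R).
    have ltk : (k < m.+1)%N by [].
    rewrite (bigD1 (Ordinal ltk)) //= big1 ?addr0 => [|j].
      by rewrite eqxx scale1r expr0 mulr1 subn0.
    by rewrite -val_eqE /= => /negPf ->; rewrite scale0r.
  have -> : Yvar ^+ (d + k) * Xvar ^+ i.+1 * (Xvar - Yvar) ^+ (m - k - i.+1)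
    = Yvar ^+ (d + k) * Xvar ^+ i * (Xvar - Yvar) ^+ (m - k - i)
      + Yvar ^+ (d + k.+1) * Xvar ^+ i * (Xvar - Yvar) ^+ (m - k.+1 - i).
    have lik : (i < m - k)%N by rewrite ltn_subRL addnC.
    have -> : (m - k.+1 - i = m - k - i.+1)%N.
      by rewrite -!subnDA addSnnS.
    rewrite -(subnSK lik) (exprS (Xvar - Yvar)) addnS !exprSr.
    rewrite (mulrAC (Yvar ^+ (d + k)) Yvar).
    rewrite -[in RHS](mulrA _ Yvar) -mulrDr -mulrDl subrK.
    by rewrite !mulrA.
  apply: SD; apply: IHi; first exact: ltnW.
  by rewrite addnS.
suff [e eE] : S (\sum_(k < m.+1) A k *: (Yvar ^+ (d + k) * Xvar ^+ (m - k))).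
  exists e; exact: esym eE.
apply: (big_ind S); [exact: S0 | exact: SD | move=> k _; apply: SZ].
have lek : (k <= m)%N by rewrite -ltnS ltn_ord.
by have := Sgen (m - k)%N k; rewrite subnn expr0 mulr1 subnK //; apply.
Qed.

Lemma zeta_polynomial_unique q n d (A : nat -> C) : (d <= n)%N ->
  exists! P, is_zeta_polynomial q n d (weight_poly n d A) P.
Proof.
move=> ledn.
have C0 k : (k <= n - d)%N -> 'C(n, n - d - k)%:R != 0 :> C.
  by move=> lek; rewrite pnatr_eq0 -lt0n bin_gt0 -subnDA leq_subr.
have weightE : weight_poly n d A - Xvar ^+ n = \sum_(k < (n - d).+1)
    A (d + k)%N *: (Yvar ^+ (d + k) * Xvar ^+ (n - d - k)).
  rewrite /weight_poly addrC addKr -{1}[d]add0n big_addn.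
  rewrite (subSn ledn).
  rewrite big_mkord.
  apply: eq_bigr => k _.
  by rewrite (addnC k) subnDA mulrC.
have [e eE] := YX_span (n - d) d (fun k => (q%:C - 1)^-1 * A (d + k)%N).
pose b k := e k / 'C(n, n - d - k)%:R.
have [g gE] := fps_geom_surj q%:C b.
have [f fE] := fps_geom_surj 1 g.
exists (\poly_(k < (n - d).+1) f k); split.
  split; first exact: size_poly.
  have bE k : (k <= n - d)%N ->
      scalar_series q (\poly_(k < (n - d).+1) f k) k = b k.
    move=> lek; rewrite -gE /scalar_series.
    apply: (@eq_fps_mul C _ _ _ (n - d)%N _ k lek) => j lej; rewrite -fE.
    apply: (@eq_fps_mul C _ _ _ (n - d)%N _ j lej) => i lei.
    by rewrite /fps_of_poly coef_poly ltnS lei.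
  rewrite (zeta_seriesE _ _ ledn).
  rewrite weightE.
  rewrite scaler_sumr; refine (etrans _ (etrans eE _)).
    apply: eq_bigr => k _; have lek : (k <= n - d)%N by rewrite -ltnS ltn_ord.
    by rewrite (bE _ lek) /b -[X in X *: _]mulr_natr (divfK (C0 _ lek)).
  by apply: eq_bigr => k _; rewrite scalerA.
move=> P [szP PE]; rewrite (zeta_seriesE _ _ ledn) in PE.
have bP k : (k <= n - d)%N -> scalar_series q P k = b k.
  move=> lek; apply: (mulIf (C0 k lek)); rewrite /b (divfK (C0 k lek)).
  rewrite mulr_natr.
  apply/eqP; rewrite -subr_eq0; apply/eqP.
  pose e' j := scalar_series q P j *+ 'C(n, n - d - j) - e j.
  apply: (@YX_inj (n - d)%N d e' _ k lek).
  under eq_bigr do rewrite /e' scalerBl.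
  rewrite big_split /= sumrN; apply/eqP; rewrite subr_eq0; apply/eqP.
  apply: (etrans PE); apply: esym; apply: (etrans eE).
  rewrite weightE scaler_sumr.
  by apply: eq_bigr => j _; rewrite scalerA.
apply/polyP => k; rewrite coef_poly ltnS.
case: leqP => [lek|ltk]; last first.
  by apply: esym; apply: nth_default; exact: leq_trans szP ltk.
apply: esym; have Pf : forall j, (j <= n - d)%N ->
  fps_mul (fps_of_poly P) (fps_geom 1) j = fps_mul f (fps_geom 1) j.
  apply: (@fps_geom_inj C q%:C) => j lej.
  rewrite -/(scalar_series q P j) (bP _ lej).
  rewrite -gE; apply: (@eq_fps_mul C _ _ _ j _ j (leqnn j)) => i _.
  by rewrite fE.
exact: (@fps_geom_inj C 1 _ _ _ Pf k lek).
Qed.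

Lemma zeta_polynomialE q n d (A : nat -> C) P : (d <= n)%N ->
  is_zeta_polynomial q n d (weight_poly n d A) P ->
  zeta_polynomial q n d (weight_poly n d A) = P.
Proof.
move=> ledn zP; have [Q [_ uQ]] := zeta_polynomial_unique q A ledn.
rewrite -(uQ P zP); apply: esym; apply: uQ.
exact: (xgetPex 0 (ex_intro _ P zP)).
Qed.

Definition riemann_hypothesis q n d W : Prop :=
  forall z : C, root (zeta_polynomial q n d W) z ->
    `|z| = ((Num.sqrt q)^-1)%:C.

(* phi_12^+ is phi12 (sqrt 3) and phi_12^- is phi12 (- sqrt 3).
   The coefficients are n%:R with n in nat because a bare ring_scope literal
   of this size is expanded to a unary number. *)
Definition phi12 (s : R) : {mpoly C[2]} :=
  Xvar ^+ 12
  - (462%:R + 264%:R * s)%:C *: (Xvar ^+ 10 * Yvar ^+ 2)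
  + (48015%:R + 27720%:R * s)%:C *: (Xvar ^+ 8 * Yvar ^+ 4)
  - (1248324%:R + 720720%:R * s)%:C *: (Xvar ^+ 6 * Yvar ^+ 6)
  + (9314415%:R + 5377680%:R * s)%:C *: (Xvar ^+ 4 * Yvar ^+ 8)
  - (17297742%:R + 9986856%:R * s)%:C *: (Xvar ^+ 2 * Yvar ^+ 10)
  + (3650401%:R + 2107560%:R * s)%:C *: Yvar ^+ 12.

End FormalWeightEnumerators.

(* Main.v *)
Require Import Defs.
From HB Require Import structures.
From mathcomp Require Import all_boot all_order all_algebra.
From mathcomp Require Import complex mpoly.
From mathcomp Require Import boolp classical_sets reals.
From mathcomp Require Import ring lra.

Set Implicit Arguments.
Unset Strict Implicit.
Unset Printing Implicit Defensive.

Import Order.TTheory GRing.Theory Num.Theory.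
Local Open Scope ring_scope.

(* Put t = 2 + s with s = sqrt 3 or - sqrt 3, so that q = 1 + t^2, let a = i t and
   w = 1 + a, so that w^12 = - q^6.  Then phi_12 is the real part
   ((x + a y)^12 + (x - a y)^12) / 2: up to the factor 1 / sqrt q, sigma_q sends
   x + a y to w (x - a y) and x - a y to (1 - a) (x + a y), and phi_12 is multiplied
   by w^12 / q^6 = -1.  By the binomial theorem
   the zeta polynomial is P(T) = - sum_(k < 11) Re (w^(k+1)) T^k, and
   (1 - 2 T + q T^2) P(T) = q^6 T^12 - q^6 T^11 + q T - 1.
   For the large q this has a real root in (0, 1/5), inside the circle of radius
   1 / sqrt q; for the small q a sign count shows that all its roots are on that
   circle. *)

(** * Roots of [a^4 + 14 a^2 + 1] and twelfth roots of unity *)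

Section TwelfthRoot.
Variables (F : numFieldType) (a : F).
Hypothesis a4 : a ^+ 4 + 14%:R * a ^+ 2 + 1 = 0.

(** The point is that [(1 + a)^6 + (1 - a)^6 = 2 (1 + a^2) (a^4 + 14 a^2 + 1)] vanishes; multiplying
    by [(1 + a)^6] gives the claim. *)
Lemma expr12_1D : (1 + a) ^+ 12 = - (1 - a ^+ 2) ^+ 6.
Proof.
have : (1 + a) ^+ 12 + (1 - a ^+ 2) ^+ 6
  = 2%:R * (1 + a) ^+ 6 * (1 + a ^+ 2) * (a ^+ 4 + 14%:R * a ^+ 2 + 1) by ring.
by rewrite a4 mulr0 => /eqP; rewrite addr_eq0 => /eqP.
Qed.

Lemma expr12_1B : (1 - a) ^+ 12 = - (1 - a ^+ 2) ^+ 6.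
Proof.
have : (1 - a) ^+ 12 + (1 - a ^+ 2) ^+ 6
  = 2%:R * (1 - a) ^+ 6 * (1 + a ^+ 2) * (a ^+ 4 + 14%:R * a ^+ 2 + 1) by ring.
by rewrite a4 mulr0 => /eqP; rewrite addr_eq0 => /eqP.
Qed.

Lemma sqr_neq1 : a ^+ 2 != 1.
Proof.
apply/eqP => a2; move: a4; rewrite -[4%N]/(2 * 2)%N exprM a2.
rewrite expr1n mulr1; have -> : 1 + 14%:R + 1 = 16%:R :> F by ring.
by apply/eqP; rewrite pnatr_eq0.
Qed.

Lemma root_neq0 : a != 0.
Proof. by apply: contra_eqN a4 => /eqP ->; rewrite !expr0n mulr0 !add0r oner_eq0. Qed.

Lemma oneB_neq0 : 1 - a != 0.
Proof.
by apply: contraNneq sqr_neq1 => /eqP; rewrite subr_eq0 => /eqP <-; rewrite expr1n.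
Qed.

(** The twelfth powers of [1 + a] and [1 - a] agree, so the order divides 12. The sixth power is not
    1, since [(1 + a)^6 = - (1 - a)^6]; fourth power 1 would force [8 a (1 + a^2) = 0], which the
    equation for [a] excludes. *)
Lemma ratio_prim_root : 12.-primitive_root ((1 + a) / (1 - a)).
Proof.
have b0 := oneB_neq0.
have a0 := root_neq0.
have e6 : ((1 + a) / (1 - a)) ^+ 6 != 1.
  rewrite expr_div_n; apply/negP => /eqP/(canRL (mulfVK (expf_neq0 6 b0))).
  rewrite mul1r => e; have : 2%:R * (1 - a) ^+ 6 = 0.
    have : (1 + a) ^+ 6 + (1 - a) ^+ 6
      = 2%:R * (1 + a ^+ 2) * (a ^+ 4 + 14%:R * a ^+ 2 + 1) by ring.
    by rewrite e a4 mulr0 -mulr2n mulr_natl.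
  by apply/eqP; rewrite mulf_neq0 ?expf_neq0 // pnatr_eq0.
have e4 : ((1 + a) / (1 - a)) ^+ 4 != 1.
  rewrite expr_div_n; apply/negP => /eqP/(canRL (mulfVK (expf_neq0 4 b0))).
  rewrite mul1r => /eqP; rewrite -subr_eq0.
  have -> : (1 + a) ^+ 4 - (1 - a) ^+ 4 = 8%:R * a * (1 + a ^+ 2) by ring.
  rewrite !mulf_eq0 pnatr_eq0 (negPf a0) /= addrC addr_eq0 => /eqP a2.
  move: a4; rewrite -[4%N]/(2 * 2)%N exprM a2 sqrrN expr1n mulrN1.
  have -> : 1 - 14%:R + 1 = - 12%:R :> F by ring.
  by apply/eqP; rewrite oppr_eq0 pnatr_eq0.
have e12 : ((1 + a) / (1 - a)) ^+ 12 = 1.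
  by rewrite expr_div_n expr12_1D -expr12_1B divff // expf_neq0.
have [m pm +] := prim_order_exists (isT : (0 < 12)%N) e12.
have dv k : (m %| k)%N -> ((1 + a) / (1 - a)) ^+ k = 1.
  by case/dvdnP => j ->; rewrite mulnC exprM (prim_expr_order pm) expr1n.
(* Every proper divisor of 12 divides 4 or 6. *)
case: m pm dv => [|[|[|[|[|[|[|[|[|[|[|[|[|m]]]]]]]]]]]]] //.
- by move=> _ /(_ 4%N isT) /eqP; rewrite (negPf e4).
- by move=> _ /(_ 4%N isT) /eqP; rewrite (negPf e4).
- by move=> _ /(_ 6%N isT) /eqP; rewrite (negPf e6).
- by move=> _ /(_ 4%N isT) /eqP; rewrite (negPf e4).
- by move=> _ /(_ 6%N isT) /eqP; rewrite (negPf e6).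
Qed.

End TwelfthRoot.

(** * The enumerators [((x + a y)^n + (x - a y)^n) / 2] and their transformation under
    [sigma_mx q] *)

Section CosineEnumerator.
Variable R : realType.
Local Open Scope complex_scope.
Local Notation C := R[i].
Local Notation X := (Xvar R).
Local Notation Y := (Yvar R).
Implicit Types (a : C) (q : R) (n : nat).

Definition cos_poly n a : {mpoly C[2]} :=
  2%:R^-1 *: ((X + a *: Y) ^+ n + (X - a *: Y) ^+ n).

Definition cos_coef n a (i : nat) : C :=
  2%:R^-1 * (a ^+ i + (- a) ^+ i) *+ 'C(n, i).

Lemma cos_coef_odd n a i : odd i -> cos_coef n a i = 0.
Proof. by move=> oi; rewrite /cos_coef exprNn -signr_odd oi mulN1r subrr mulr0 mul0rn. Qed.

Lemma cos_polyE n a : (1 < n)%N -> cos_poly n a = weight_poly n 2 (cos_coef n a).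
Proof.
move=> n1; have -> : cos_poly n a =
    \sum_(0 <= i < n.+1) cos_coef n a i *: (X ^+ (n - i) * Y ^+ i).
  rewrite big_mkord /cos_poly -scaleNr !exprDn -big_split scaler_sumr.
  apply: eq_bigr => i _; rewrite /= !exprZn -!scalerAr -mulrnDl -scalerDl.
  by rewrite -scalerMnr scalerA scalerMnl.
rewrite /weight_poly big_ltn // big_ltn ?ltnS 1?ltnW // addrA.
rewrite [cos_coef n a 1]cos_coef_odd // scale0r addr0 subn0 expr0 mulr1.
by rewrite /cos_coef !expr0 bin0 -mulr2n mulVf ?pnatr_eq0 // mulr1n scale1r.
Qed.

(** As [q - 1 = - a^2], up to [1 / sqrt q] the form [x + b y] goes to [(x - b^2 y) + b (x - y) = (1
    + b) (x - b y)]. With [b = a] and [b = - a] the two powers trade places. *)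
Lemma mx_act_cos_poly n a q : 0 < q -> q%:C = 1 - a ^+ 2 ->
  mx_act (cos_poly n a) (sigma_mx q) =
  ((Num.sqrt q)^-1)%:C ^+ n *:
    (2%:R^-1 *: ((1 + a) ^+ n *: (X - a *: Y) ^+ n
               + (1 - a) ^+ n *: (X + a *: Y) ^+ n)).
Proof.
move=> q0 qa; rewrite /mx_act /cos_poly.
set lq := [tuple _ | _ < _]; set c := ((Num.sqrt q)^-1)%:C.
have lX : X \mPo lq = c *: (X - a ^+ 2 *: Y).
  rewrite comp_mpolyXU -tnth_nth tnth_mktuple /sigma_mx !mxE /= qa mulr1.
  by rewrite -/c scalerDr (addrC 1) addrK -scalerA scaleNr.
have lY : Y \mPo lq = c *: (X - Y).
  rewrite comp_mpolyXU -tnth_nth tnth_mktuple /sigma_mx !mxE /= -/c.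
  by rewrite mulr1 mulrN1 scalerBr scaleNr.
have lXY b : b ^+ 2 = a ^+ 2 -> (X + b *: Y) \mPo lq = c *: ((1 + b) *: (X - b *: Y)).
  move=> b2; rewrite rmorphD /= comp_mpolyZ lX lY -b2 -!mul_mpolyC.
  by rewrite !rmorphD !rmorphXn /=; ring.
rewrite comp_mpolyZ rmorphD !rmorphXn /= lXY // -scaleNr lXY ?sqrrN //.
rewrite !exprZn -scalerDr scalerA mulrC -scalerA scaleNr opprK.
by rewrite -scaleNr.
Qed.

Lemma mcoeff_weight_poly n d (A : nat -> C) m :
  (0 < d)%N -> (weight_poly n d A)@_m != 0 -> m 1%R = 0%N \/ A (m 1%R) != 0.
Proof.
move=> d0; have XYE i j : X ^+ i * Y ^+ j = 'X_[U_(0) *+ i + U_(1) *+ j].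
  by rewrite mpolyXD !mpolyXn.
have m1 i j : (U_(0%R : 'I_2) *+ i + U_(1) *+ j)%MM 1%R = j.
  by rewrite mnmDE !mulmnE !mnm1E /= mul0n mul1n.
rewrite /weight_poly mcoeffD raddf_sum /= => h.
have : (X ^+ n)@_m != 0 \/ \sum_(d <= i < n.+1) (A i *: (X ^+ (n - i) * Y ^+ i))@_m != 0.
  by apply/orP; apply: contraNT h; rewrite negb_or !negbK => /andP[/eqP-> /eqP->]; rewrite addr0.
case=> [|{}h].
  have -> : X ^+ n = X ^+ n * Y ^+ 0 by rewrite expr0 mulr1.
  by rewrite XYE mcoeffX pnatr_eq0 eqb0 negbK => /eqP <-; left; rewrite m1.
have [/eqP Am|] := boolP (A (m 1%R) == 0); last by right.
case/eqP: h; apply: big1 => i _; rewrite mcoeffZ XYE mcoeffX.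
case: eqP => [e|_]; last by rewrite mulr0.
by move: Am; rewrite -e m1 => ->; rewrite mul0r.
Qed.

Lemma cos_poly_divisible n a : (1 < n)%N -> divisible_by 2 (cos_poly n a).
Proof.
move=> n1 m; rewrite cos_polyE // => /(@mcoeff_weight_poly _ 2 _ _ isT) [-> //|].
by apply: contraNT; rewrite dvdn2 negbK => /cos_coef_odd->.
Qed.

Lemma invsqrtX_mul q k : 0 < q -> ((Num.sqrt q)^-1)%:C ^+ (2 * k) * q%:C ^+ k = 1 :> C.
Proof.
move=> q0; rewrite -!rmorphXn -rmorphM /= exprM exprVn sqr_sqrtr ?ltW //.
by rewrite -exprMn mulVf ?gt_eqF // expr1n.
Qed.

(** The coefficient of [y^2] is [66 a^2], and the common twelfth power [- q^6] of [1 + a] and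
    [1 - a] cancels [(1 / sqrt q)^12] up to the sign. *)
Lemma cos_poly_fwe a q : 0 < q -> q%:C = 1 - a ^+ 2 ->
  a ^+ 4 + 14%:R * a ^+ 2 + 1 = 0 ->
  formal_weight_enumerator q 12 2 (cos_poly 12 a).
Proof.
move=> q0 qa a4; have a0 := root_neq0 a4.
split => //.
- split=> //; apply: contra_eqN qa => /eqP ->.
  by rewrite eq_sym subr_eq addrC -subr_eq subrr eq_sym expf_eq0.
- exists (cos_coef 12 a); last exact: cos_polyE.
  rewrite /cos_coef sqrrN -mulr2n -[a ^+ 2 *+ 2]mulr_natl mulKf ?pnatr_eq0 //.
  by rewrite -mulr_natl mulf_neq0 ?expf_neq0 // pnatr_eq0.
- rewrite (mx_act_cos_poly _ q0 qa) (expr12_1D a4) (expr12_1B a4) /cos_poly.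
  move: ((X - a *: Y) ^+ 12) ((X + a *: Y) ^+ 12) => u v.
  rewrite -scalerDr [v + u]addrC !scalerA -[RHS]scaleNr; congr (_ *: _).
  by rewrite mulrN mulrAC -qa (invsqrtX_mul 6 q0) mul1r.
Qed.

(** * Extremality: [d] is at most 2 in degree 12 *)

Lemma meval_weight_poly n d (A : nat -> C) (v : 'I_2 -> C) :
  (weight_poly n d A).@[v] =
  v 0 ^+ n + \sum_(d <= i < n.+1) A i * (v 0 ^+ (n - i) * v 1 ^+ i).
Proof.
rewrite /weight_poly rmorphD rmorph_sum rmorphXn /= mevalXU; congr (_ + _).
by apply: eq_bigr => i _; rewrite mevalZ rmorphM !rmorphXn /= !mevalXU.
Qed.

Lemma size_linear_exp (p q : {poly C}) i j :
  (size p <= 2)%N -> (size q <= 2)%N -> (size (p ^+ i * q ^+ j)%R <= (i + j).+1)%N.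
Proof.
have expS (r : {poly C}) k : (size r <= 2)%N -> (size (r ^+ k)%R <= k.+1)%N.
  move=> r2; rewrite (leq_trans (size_poly_exp_leq _ _)) // ltnS.
  by rewrite -[leqRHS]mul1n leq_mul2r orbC -subn1 leq_subLR r2.
move=> p2 q2; rewrite (leq_trans (size_polyMleq _ _)) //.
by rewrite -subn1 leq_subLR add1n -addSn -addnS leq_add ?expS.
Qed.

(** The difference of the two sides has degree below [n], its coefficient of [X^n] having cancelled,
    yet it vanishes at the [n] distinct powers of [e]. *)
Lemma poly_const_on_roots n (e : C) (p : {poly C}) : n.-primitive_root e ->
  (size p <= n.+1)%N -> (forall k, p.[e ^+ k] = p.[1]) ->
  p = (p.[1])%:P + p`_n *: ('X^n - 1).
Proof.
move=> pe sp pM; have n0 := prim_order_gt0 pe.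
apply/eqP; rewrite -subr_eq0; apply/eqP.
apply: (@roots_geq_poly_eq0 _ _ [seq e ^+ k | k <- iota 0 n]).
- apply/allP => _ /mapP[k _ ->]; rewrite rootE !hornerE pM -exprM mulnC exprM.
  by rewrite (prim_expr_order pe) expr1n subrr mulr0 addr0 subrr.
- rewrite map_inj_in_uniq ?iota_uniq // => i j; rewrite !mem_iota !add0n /= => lin ljn.
  by move/eqP; rewrite (eq_prim_root_expr pe) /eqn !modn_small // => /eqP.
- rewrite size_map size_iota; apply/leq_sizeP => k; rewrite leq_eqVlt.
  case/orP => [/eqP<-|nk]; rewrite coefB coefD coefC coefZ coefB coefXn coef1.
    by rewrite eqxx (gtn_eqF n0) subr0 mulr1 add0r subrr.
  rewrite (gtn_eqF nk) (gtn_eqF (leq_trans n0 (ltnW nk))).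
  by rewrite (nth_default _ (leq_trans sp nk)) subrr mulr0 addr0 subrr.
Qed.

(** Contact of order 3 allows the first two derivatives to be compared at 1. They give
    [c = a (2 a)^(n+1)] and [c = a^2 (2 a)^n]; the first value is twice the second, so both are
    0. *)
Lemma linear_pow_contact n (a M c : C) (r : {poly C}) :
  M%:P + c *: ('X^(n.+2) - 1) = (a *: ('X + 1)) ^+ n.+2 + ('X - 1) ^+ 3 * r -> a = 0.
Proof.
pose L : {poly C} := 'X - 1.
have dL p : (L * p)^`() = p + L * p^`() by rewrite derivM derivB derivX derivC subr0 mul1r.
have L1 p : (L * p).[1] = 0 by rewrite hornerM hornerXsubC subrr mul0r.
pose s := L * (L * r); have -> : ('X - 1) ^+ 3 * r = L * s by rewrite /s /L; ring.
have s1 : s^`().[1] = 0 by rewrite dL hornerD !L1 addr0.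
have q' : (a *: ('X + 1) : {poly C})^`() = a%:P.
  by rewrite derivZ derivD derivX derivC addr0 alg_polyC.
have q1 : (a *: ('X + 1) : {poly C}).[1] = a * 2%:R.
  by rewrite hornerZ hornerD hornerX hornerC.
move: (a *: ('X + 1)) q' q1 => q q' q1 e.
have e' : c *: (n.+2%:R *: 'X^(n.+1)) = n.+2%:R *: (a%:P * q ^+ n.+1) + (s + L * s^`()).
  have := congr1 deriv e; rewrite !derivD dL deriv_exp q' derivC add0r derivZ derivB.
  by rewrite derivXn derivC subr0 -(scaler_nat _ 'X^_) -(scaler_nat _ (a%:P * _)).
have D1 : c = a * (a * 2%:R) ^+ n.+1.
  apply: (@mulIf _ n.+2%:R); first by rewrite pnatr_eq0.
  have := congr1 (horner^~ 1) e'; rewrite !(hornerD, L1, addr0, s1) !hornerZ hornerXn expr1n.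
  by rewrite hornerM hornerC horner_exp q1 mulr1 => ->; rewrite mulrC.
have D2 : c = a * a * (a * 2%:R) ^+ n.
  apply: (@mulIf _ (n.+2%:R * n.+1%:R)); first by rewrite mulf_neq0 ?pnatr_eq0.
  have := congr1 (fun p => p^`().[1]) e'.
  rewrite !(derivD, dL, hornerD, L1, s1, addr0) !derivZ derivXn derivM derivC mul0r add0r.
  rewrite deriv_exp q' -(scaler_nat _ 'X^_) -(scaler_nat _ (a%:P * _)) /= !hornerZ hornerXn expr1n mulr1 => ->.
  by rewrite hornerM hornerC hornerZ hornerM hornerC horner_exp q1; ring.
apply/eqP; move: (etrans (esym D1) D2).
have -> : a * (a * 2%:R) ^+ n.+1 = a * a * (a * 2%:R) ^+ n + a * a * (a * 2%:R) ^+ n.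
  by rewrite exprS; ring.
move/eqP; rewrite -subr_eq0 addrK mulf_eq0 expf_eq0 !mulf_eq0 pnatr_eq0 orbF.
by rewrite orbb => /orP[|/andP[]].
Qed.

Definition point (x y : C) : 'I_2 -> C := fun i => if i == 0 then x else y.

Lemma meval_evenY W x y : divisible_by 2 W -> W.@[point x (- y)] = W.@[point x y].
Proof.
move=> W2; rewrite !mevalE; apply: eq_big_seq => m; rewrite mcoeff_msupp => Wm /=.
congr (_ * _); apply: eq_bigr => i _; rewrite /point; case: eqP => // i0.
have -> : i = 1.
  case: i i0 => [[|[|//]] ?] i0; last exact: val_inj.
  by case: i0; apply: val_inj.
by rewrite exprNn -signr_odd; move: (W2 m Wm); rewrite dvdn2 => /negPf ->; rewrite mul1r.
Qed.

Lemma meval_weight_polyZ n d (A : nat -> C) l x y :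
  (weight_poly n d A).@[point (l * x) (l * y)] =
  l ^+ n * (weight_poly n d A).@[point x y].
Proof.
rewrite !meval_weight_poly /point /= exprMn mulrDr mulr_sumr; congr (_ + _).
apply: eq_big_nat => i /andP[_]; rewrite ltnS => lein.
by rewrite !exprMn -[in l ^+ n](subnK lein) exprD; ring.
Qed.

Lemma meval_mx_act W q (a x y : C) : q%:C = 1 - a ^+ 2 ->
  (mx_act W (sigma_mx q)).@[point x y] =
  W.@[point (((Num.sqrt q)^-1)%:C * (x - a ^+ 2 * y))
            (((Num.sqrt q)^-1)%:C * (x - y))].
Proof.
move=> qa; rewrite /mx_act comp_mpoly_meval; apply: meval_eq => i.
rewrite tnth_mktuple rmorphD /= !mevalZ !mevalXU /sigma_mx !mxE /point /= qa.
by case: eqP => _; ring.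
Qed.

(* In the coordinates [u = x + a y], [v = x - a y] (below scaled by [2 a]) the
   invariance says [W (u, v) = W (v, u)] and
   [W ((1 + a) v, (1 - a) u) = - q^6 W (u, v)], so [W (z, 1)] takes one value at the
   twelve powers of [(1 + a) / (1 - a)] and equals [M + c (z^12 - 1)].  If [d > 2],
   then [W - x^12] vanishes to order 3 at [y = 0], that is at [z = 1], which no
   choice of [M] and [c] allows. *)
Lemma fwe12_min_weight a q d W : q%:C = 1 - a ^+ 2 ->
  a ^+ 4 + 14%:R * a ^+ 2 + 1 = 0 ->
  formal_weight_enumerator q 12 d W -> divisible_by 2 W -> (d <= 2)%N.
Proof.
move=> qa a4 [[q0 _] /andP[d0 d12] [A _ WE] Wact] W2.
have [//|d2] := leqP d 2.
have a0 := root_neq0 a4.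
have b0 := oneB_neq0 a4; pose e := (1 + a) / (1 - a).
(* At this point [x + a y = 2 a z] and [x - a y = 2 a]. *)
pose F z := W.@[point (a * (z + 1)) (z - 1)].
have Frot z : F (e * z) = F z.
  (* Scaling by [1 - a] clears the denominator of [e]. The scaled point is, up to [1 / sqrt q], the
     image under [sigma_mx q] of [(a (z + 1), 1 - z)], and evenness in [y] turns [1 - z] into
     [z - 1]. *)
  apply: (mulfI (expf_neq0 12 b0)).
  rewrite /F WE -meval_weight_polyZ -WE.
  have -> : (1 - a) * (a * (e * z + 1)) = a * (z + 1) - a ^+ 2 * (1 - z).
    rewrite /e; field; exact: b0.
  have -> : (1 - a) * (e * z - 1) = a * (z + 1) - (1 - z).
    rewrite /e; field; exact: b0.
  rewrite (expr12_1B a4).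
  have := congr1 (meval (point (a * (z + 1)) (1 - z))) Wact.
  rewrite (meval_mx_act _ _ _ qa) WE meval_weight_polyZ -WE.
  rewrite -(opprB z 1) rmorphN /= (meval_evenY _ _ W2) opprB => h.
  by rewrite mulNr -mulrN -h mulrA -qa (mulrC (q%:C ^+ 6)) (invsqrtX_mul 6 q0) mul1r.
pose g := (a *: ('X + 1)) ^+ 12 + \sum_(d <= i < 13)
   A i *: ((a *: ('X + 1)) ^+ (12 - i) * ('X - 1) ^+ i) : {poly C}.
have gE z : g.[z] = F z.
  rewrite /g /F WE meval_weight_poly /point /= hornerD horner_sum !hornerE.
  congr (_ + _); apply: eq_bigr => i _.
  by rewrite !hornerE.
have gM k : g.[e ^+ k] = g.[1].
  elim: k => [|k IHk]; first by rewrite expr0.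
  by rewrite exprS gE Frot -gE IHk.
have linXa : (size (a *: ('X + 1) : {poly C})%R <= 2)%N.
  by rewrite (leq_trans (size_scale_leq _ _)) // size_XaddC.
have linX1 : (size ('X - 1 : {poly C})%R <= 2)%N by rewrite size_XsubC.
have size_g : (size g <= 13)%N.
  rewrite (leq_trans (size_polyD _ _)) // geq_max; apply/andP; split.
    by have := size_linear_exp 12 0 linXa linX1; rewrite expr0 mulr1.
  apply: (leq_trans (size_sum _ _ _)); apply/bigmax_leqP_seq => i; rewrite mem_index_iota.
  move=> /andP[_ i13] _; rewrite (leq_trans (size_scale_leq _ _)) //.
  by rewrite (leq_trans (size_linear_exp _ _ linXa linX1)) // subnK.
have [r gr] : exists r, g = (a *: ('X + 1)) ^+ 12 + ('X - 1) ^+ 3 * r.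
  exists (\sum_(d <= i < 13) A i *: ((a *: ('X + 1)) ^+ (12 - i) * ('X - 1) ^+ (i - 3))).
  rewrite /g mulr_sumr; congr (_ + _); apply: eq_big_nat => i /andP[di _].
  have i3 : (3 <= i)%N by rewrite (leq_trans d2).
  rewrite -scalerAr mulrCA -exprD subnKC //.
have gc := poly_const_on_roots (ratio_prim_root a4) size_g gM.
by case/eqP: a0; exact: (linear_pow_contact (etrans (esym gc) gr)).
Qed.

(** * The zeta polynomial in closed form *)

Definition cos_zeta n a : {poly C} :=
  \poly_(k < n.-1) (- (2%:R^-1 * ((1 + a) ^+ k.+1 + (1 - a) ^+ k.+1))).

(** With [w = 1 + a] one has [w - 1 = a] and [w - q = a w], so summing against each of the two
    geometric series divides the powers of [w] by [a] once; likewise for [1 - a], with [- a]. *)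
Lemma scalar_series_cos_zeta n a q k : a != 0 -> q%:C = 1 - a ^+ 2 -> (k < n.-1)%N ->
  scalar_series q (cos_zeta n a) k =
  (1 - 2%:R^-1 * ((1 + a) ^+ k.+2 + (1 - a) ^+ k.+2)) / a ^+ 2.
Proof.
move=> a0 qa kn; rewrite /scalar_series qa.
have h1 j : (j < n.-1)%N -> fps_mul (fps_of_poly (cos_zeta n a)) (fps_geom 1) j =
    1 - ((1 + a) ^+ j.+2 - (1 - a) ^+ j.+2) / (2%:R * a).
  elim: j => [|j IHj] jn; last rewrite fps_mul_geomS (IHj (ltnW jn)).
    by rewrite fps_mul_geom0 /fps_of_poly coef_poly jn; field; exact: a0.
  rewrite /fps_of_poly coef_poly jn !(exprS _ j.+2) !(exprS _ j.+1).
  by field; exact: a0.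
elim: k kn => [|k IHk] kn.
  by rewrite fps_mul_geom0 h1 //; field; exact: a0.
rewrite fps_mul_geomS (IHk (ltnW kn)) h1 // !(exprS _ k.+2) !(exprS _ k.+1).
by field; exact: a0.
Qed.

(** Everything is expanded in [y] and [x - y] through [x + b y = (x - y) + (1 + b) y], with [b = a],
    [- a], and [0] for [x^n]. The coefficients at [i = 0] and [i = 1] cancel, so the sum starts at
    [d = 2], and the others are those of [scalar_series_cos_zeta]. *)
Lemma cos_zeta_is_zeta n a q : (1 < n)%N -> a != 0 -> q%:C = 1 - a ^+ 2 ->
  is_zeta_polynomial q n 2 (cos_poly n a) (cos_zeta n a).
Proof.
case: n => [|[|n]] // _ a0 qa; split; first by rewrite subSS subn1 /= size_poly.
rewrite zeta_seriesE // qa !subSS subn0.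
pose c m := (1 - 2%:R^-1 * ((1 + a) ^+ m + (1 - a) ^+ m)) / a ^+ 2.
have -> : (1 - a ^+ 2 - 1)^-1 = - (a ^+ 2)^-1 by rewrite addrAC subrr sub0r invrN.
have binom b : (X + b *: Y) ^+ n.+2 =
    \sum_(0 <= i < n.+3) ((1 + b) ^+ i *+ 'C(n.+2, i)) *: (Y ^+ i * (X - Y) ^+ (n.+2 - i)).
  have -> : X + b *: Y = (X - Y) + (1 + b) *: Y by rewrite scalerDl scale1r addrA subrK.
  rewrite exprDn big_mkord; apply: eq_bigr => i _.
  by rewrite exprZn -scalerAr scalerMnl mulrC.
have -> : - (a ^+ 2)^-1 *: (cos_poly n.+2 a - X ^+ n.+2) =
    \sum_(0 <= i < n.+3) (c i *+ 'C(n.+2, i)) *: (Y ^+ i * (X - Y) ^+ (n.+2 - i)).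
  have XE : X ^+ n.+2 = (X + 0 *: Y) ^+ n.+2 by rewrite scale0r addr0.
  rewrite /cos_poly -scaleNr XE !binom -big_split scaler_sumr /= -sumrB scaler_sumr.
  apply: eq_bigr => i _; rewrite -scalerDl scalerA -scalerBl scalerA; congr (_ *: _).
  rewrite addr0 expr1n /c -mulrnDl mulrnAr -mulrnBl mulrnAr; congr (_ *+ _).
  by field; exact: a0.
rewrite big_ltn // big_ltn // /c !expr0 !expr1.
have -> : (1 - 2%:R^-1 * (1 + 1)) / a ^+ 2 = 0 by field; exact: a0.
have -> : (1 - 2%:R^-1 * ((1 + a) + (1 - a))) / a ^+ 2 = 0 by field; exact: a0.
rewrite !mul0rn !scale0r !add0r !big_add1 /= big_mkord.
apply: eq_bigr => k _; have kn : (k <= n)%N by rewrite -ltnS.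
rewrite scalar_series_cos_zeta // add2n !subSS; congr (_ *+ _ *: _).
by rewrite -(bin_sub (_ : k.+2 <= n.+2)%N).
Qed.

(** The quadratic is [(1 - (1 + a) z) (1 - (1 - a) z)], and each factor telescopes one of two
    geometric sums; both twelfth powers equal [- (1 - a^2)^6]. *)
Lemma cos_zeta_horner a z : a ^+ 4 + 14%:R * a ^+ 2 + 1 = 0 ->
  (1 - 2%:R * z + (1 - a ^+ 2) * z ^+ 2) * (cos_zeta 12 a).[z] =
  (1 - a ^+ 2) ^+ 6 * z ^+ 12 - (1 - a ^+ 2) ^+ 6 * z ^+ 11 + (1 - a ^+ 2) * z - 1.
Proof.
move=> a4.
have geom b : (1 - b * z) * \sum_(k < 11) b ^+ k.+1 * z ^+ k = b - b ^+ 12 * z ^+ 11.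
  by rewrite !big_ord_recr big_ord0 /=; ring.
rewrite horner_poly.
have -> : \sum_(i < 12.-1) (- (2^-1 * ((1 + a) ^+ i.+1 + (1 - a) ^+ i.+1))) * z ^+ i
   = - 2^-1 * (\sum_(k < 11) (1 + a) ^+ k.+1 * z ^+ k + \sum_(k < 11) (1 - a) ^+ k.+1 * z ^+ k).
  rewrite -big_split mulr_sumr; apply: eq_bigr => i _ /=; ring.
have g1 := geom (1 + a); have g2 := geom (1 - a).
rewrite (expr12_1D a4) in g1; rewrite (expr12_1B a4) in g2.
move: g1 g2; set s1 := \sum_(k < 11) _; set s2 := \sum_(k < 11) _ => g1 g2.
have -> : (1 - 2 * z + (1 - a ^+ 2) * z ^+ 2) * (- 2^-1 * (s1 + s2)) =
  - 2^-1 * ((1 - (1 - a) * z) * ((1 - (1 + a) * z) * s1) + (1 - (1 + a) * z) * ((1 - (1 - a) * z) * s2)) by ring.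
by rewrite g1 g2; field.
Qed.

(** * Identification of [phi12] with a cosine enumerator *)

Lemma phi12E (s : R) : s ^+ 2 = 3%:R -> phi12 s = cos_poly 12 ('i * (2%:R + s)%:C).
Proof.
(* This is [(2 + s)^2] reduced by [s^2 = 3]; its powers are reduced in the same way. *)
move=> s3; pose t2 := 7%:R + 4%:R * s.
have t4 : t2 ^+ 2 = 97%:R + 56%:R * s.
  have -> : t2 ^+ 2 = 49%:R + 56%:R * s + 16%:R * s ^+ 2 by rewrite /t2; ring.
  by rewrite s3; ring.
have t6 : t2 ^+ 3 = 1351%:R + 780%:R * s.
  rewrite exprS t4; have -> : t2 * (97%:R + 56%:R * s) = 679%:R + 780%:R * s + 224%:R * s ^+ 2.
    by rewrite /t2; ring.
  by rewrite s3; ring.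
have t8 : t2 ^+ 4 = 18817%:R + 10864%:R * s.
  rewrite -[4%N]/(2 * 2)%N exprM t4.
  have -> : (97%:R + 56%:R * s) ^+ 2 = 9409%:R + 10864%:R * s + 3136%:R * s ^+ 2 by ring.
  by rewrite s3; ring.
have t10 : t2 ^+ 5 = 262087%:R + 151316%:R * s.
  rewrite exprS t8.
  have -> : t2 * (18817%:R + 10864%:R * s) = 131719%:R + 151316%:R * s + 43456%:R * s ^+ 2.
    by rewrite /t2; ring.
  by rewrite s3; ring.
have t12 : t2 ^+ 6 = 3650401%:R + 2107560%:R * s.
  rewrite -[6%N]/(3 * 2)%N exprM t6.
  have -> : (1351%:R + 780%:R * s) ^+ 2 = 1825201%:R + 2107560%:R * s + 608400%:R * s ^+ 2 by ring.
  by rewrite s3; ring.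
have phiE c2 c4 c6 c8 c10 c12 : 462%:R + 264%:R * s = c2 -> 48015%:R + 27720%:R * s = c4 ->
    1248324%:R + 720720%:R * s = c6 -> 9314415%:R + 5377680%:R * s = c8 ->
    17297742%:R + 9986856%:R * s = c10 -> 3650401%:R + 2107560%:R * s = c12 ->
    phi12 s = X ^+ 12 - c2%:C *: (X ^+ 10 * Y ^+ 2) + c4%:C *: (X ^+ 8 * Y ^+ 4)
      - c6%:C *: (X ^+ 6 * Y ^+ 6) + c8%:C *: (X ^+ 4 * Y ^+ 8)
      - c10%:C *: (X ^+ 2 * Y ^+ 10) + c12%:C *: Y ^+ 12.
  by do 6 move=> <-.
(* The factors 66, 495, 924, 495, 66 are the binomials ['C(12, 2 k)] for [k] from 1 to 5. *)
have c2 : 462%:R + 264%:R * s = 66%:R * t2 by rewrite /t2; ring.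
have c4 : 48015%:R + 27720%:R * s = 495%:R * t2 ^+ 2 by rewrite t4; ring.
have c6 : 1248324%:R + 720720%:R * s = 924%:R * t2 ^+ 3 by rewrite t6; ring.
have c8 : 9314415%:R + 5377680%:R * s = 495%:R * t2 ^+ 4 by rewrite t8; ring.
have c10 : 17297742%:R + 9986856%:R * s = 66%:R * t2 ^+ 5 by rewrite t10; ring.
rewrite {phiE}(phiE _ _ _ _ _ _ c2 c4 c6 c8 c10 (esym t12)).
clear t4 t6 t8 t10 t12 c2 c4 c6 c8 c10.
set a := 'i * _.
have a2 : a ^+ 2 = - t2%:C.
  rewrite /a exprMn sqr_i mulN1r -rmorphXn; congr (- _%:C).
  have -> : (2%:R + s) ^+ 2 = 4%:R + 4%:R * s + s ^+ 2 by ring.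
  by rewrite s3 /t2; ring.
have binom (u v : {mpoly C[2]}) : (u + v) ^+ 12 + (u - v) ^+ 12 =
  2%:R * (u ^+ 12 + 66%:R * (u ^+ 10 * v ^+ 2) + 495%:R * (u ^+ 8 * v ^+ 4)
  + 924%:R * (u ^+ 6 * v ^+ 6) + 495%:R * (u ^+ 4 * v ^+ 8) + 66%:R * (u ^+ 2 * v ^+ 10) + v ^+ 12).
  by ring.
have half2 (w : {mpoly C[2]}) : 2%:R^-1 *: (2%:R * w) = w.
  by rewrite mulr_natl -(scaler_nat 2 w) scalerA mulVf ?scale1r // pnatr_eq0.
have -> : cos_poly 12 a = _ := etrans (congr1 _ (binom X (a *: Y))) (half2 _).
clear half2 binom.
have aY k : (a *: Y) ^+ (2 * k) = (- t2%:C) ^+ k *: Y ^+ (2 * k).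
  by rewrite exprZn exprM a2.
rewrite (aY 1%N) (aY 2%N) (aY 3%N) (aY 4%N) (aY 5%N) (aY 6%N).
rewrite -!mul_mpolyC !rmorphM !rmorphXn !rmorphN /= !rmorph_nat.
ring.
Qed.

(** * Location of the zeros *)

Lemma normc_invsqrt q (u v : R) : 0 < q -> q * (u ^+ 2 + v ^+ 2) = 1 ->
  `|u +i* v| = ((Num.sqrt q)^-1)%:C.
Proof.
move=> q0 e; rewrite normc_def /=; congr (_%:C).
by rewrite -sqrtrV ?ltW // -[X in Num.sqrt X](mulKf (lt0r_neq0 q0)) e mulr1.
Qed.

(** The discriminant is negative, so the two roots are complex conjugates with product [1 / q]. *)
Lemma quad_root_norm q (x : R) (z : C) : 0 < q -> x ^+ 2 < 4%:R * q ->
  q%:C * z ^+ 2 - x%:C * z + 1 = 0 -> `|z| = ((Num.sqrt q)^-1)%:C.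
Proof.
case: z => u v q0 xq /eqP; rewrite expr2 eq_complex /= !(mul0r, mulr0, subr0, addr0).
case/andP=> /eqP re /eqP im; apply: normc_invsqrt => //.
have [v0|v0] := eqVneq v 0.
  move: re; rewrite v0 mulr0 subr0 => re; exfalso.
  by have := sqr_ge0 (2%:R * q * u - x); nra.
have x2 : x = 2%:R * q * u by apply: (mulIf v0); lra.
by rewrite x2 in re; lra.
Qed.

Lemma sqr_root_norm q (z : C) : 0 < q ->
  q%:C * z ^+ 2 - 1 = 0 -> `|z| = ((Num.sqrt q)^-1)%:C.
Proof.
case: z => u v q0 /eqP; rewrite expr2 eq_complex /= !(mul0r, mulr0, subr0, addr0).
case/andP=> /eqP re /eqP im; apply: normc_invsqrt => //.
have : u * v = 0 by apply: (mulfI (lt0r_neq0 q0)); rewrite mulr0; lra.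
move/eqP; rewrite mulf_eq0 => /orP[]/eqP uv0; rewrite uv0 in re *; nra.
Qed.

(** The sign changes give four distinct real roots between -2 and 3/2. A further root [w] would be a
    fifth, too many for degree at most 4. *)
Lemma quartic_roots_real (p : {poly R}) (w : C) : (size p <= 5)%N ->
  0 < p.[-2%:R] -> p.[-1] < 0 -> 0 < p.[0] -> p.[1] < 0 -> 0 < p.[3%:R / 2%:R] ->
  root (map_poly (real_complex R) p) w ->
  exists2 x : R, w = x%:C & x ^+ 2 < 4%:R.
Proof.
move=> sp p1 p2 p3 p4 p5 pw.
have up (r : {poly R}) (u v : R) : u <= v -> r.[u] < 0 -> 0 < r.[v] ->
    exists x, [/\ u < x, x < v & root r x].
  move=> uv pu pv; have := @poly_ivt R r u v uv.
  rewrite (ltW pu) (ltW pv) => /(_ isT) [x /andP[ux xv] rx].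
  exists x; split=> //; rewrite lt_neqAle ?ux ?xv andbT; apply/eqP => e.
    by rewrite e (eqP rx) ltxx in pu.
  by rewrite -e (eqP rx) ltxx in pv.
have down (u v : R) : u <= v -> 0 < p.[u] -> p.[v] < 0 -> exists x, [/\ u < x, x < v & root p x].
  move=> uv pu pv; have [||x [ux xv rx]] := up (- p) u v uv; rewrite ?hornerN ?oppr_lt0 ?oppr_gt0 //.
  by exists x; split; rewrite // -rootN.
have [|x1 [l1 g1 r1]] := down _ _ _ p1 p2; first by lra.
have [|x2 [l2 g2 r2]] := up p _ _ _ p2 p3; first by lra.
have [|x3 [l3 g3 r3]] := down _ _ _ p3 p4; first by lra.
have [|x4 [l4 g4 r4]] := up p _ _ _ p4 p5; first by lra.
have bound (x : R) : - 2%:R < x -> x < 2%:R -> x ^+ 2 < 4%:R by move=> *; nra.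
pose rs := [:: x1; x2; x3; x4].
have : w \in [seq x%:C | x <- rs].
  apply: contraTT pw => wrs; apply/negP => pw.
  have p0 : p != 0 by apply: contraTneq p1 => ->; rewrite horner0 ltxx.
  have /eqP : map_poly (real_complex R) p = 0; last by rewrite map_poly_eq0 (negPf p0).
  apply: (@roots_geq_poly_eq0 _ _ (w :: [seq x%:C | x <- rs])).
  - by rewrite /= pw !fmorph_root r1 r2 r3 r4.
  - rewrite cons_uniq wrs map_inj_uniq; last by move=> x y [].
    by rewrite /= !inE !negb_or; do !(apply/andP; split) => //; rewrite lt_eqF //; lra.
  - by rewrite size_map_poly.
by rewrite /= !inE => /or4P[]/eqP->;
  [exists x1 | exists x2 | exists x3 | exists x4] => //; apply: bound; lra.
Qed.

Lemma zeta_cos_poly a q : a != 0 -> q%:C = 1 - a ^+ 2 ->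
  zeta_polynomial q 12 2 (cos_poly 12 a) = cos_zeta 12 a.
Proof.
move=> a0 qa; rewrite cos_polyE //; apply: zeta_polynomialE => //.
by rewrite -cos_polyE //; apply: cos_zeta_is_zeta.
Qed.

(* With [w = q z + 1/z] the polynomial [q^6 z^12 - q^6 z^11 + q z - 1] is
   [(q z^2 - 1) z^5 (w - 2) Q(w)] for the quartic [Q] below; [q] near [1.072] puts
   the roots of [Q] in [(-2, 2)], where [w^2 < 4 q] forces [|z|^2 = 1/q]. *)
Lemma cos_poly_RH (t : R) q : q = 1 + t ^+ 2 -> q ^+ 2 - 16%:R * q + 16%:R = 0 ->
  107%:R / 100%:R < q -> q < 1075%:R / 1000%:R ->
  ('i * t%:C) ^+ 4 + 14%:R * ('i * t%:C) ^+ 2 + 1 = 0 ->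
  riemann_hypothesis q 12 2 (cos_poly 12 ('i * t%:C)).
Proof.
move=> qt q2 ql qr a4 z; have q0 : 0 < q by lra.
have qa : q%:C = 1 - ('i * t%:C) ^+ 2.
  by rewrite exprMn sqr_i mulN1r opprK -rmorphXn -(rmorph1 (real_complex R)) -rmorphD qt.
have a0 := root_neq0 a4.
rewrite (zeta_cos_poly a0 qa) rootE => /eqP Pz.
have := cos_zeta_horner z a4; rewrite Pz mulr0 -qa => /esym N0.
pose Q : {poly R} := 'X^4 + (2%:R - q) *: 'X^3 + (4%:R - 6%:R * q) *: 'X^2
  + (3%:R * q ^+ 2 - 12%:R * q + 8%:R) *: 'X + ((3%:R * q - 4%:R) ^+ 2)%:P.
(* Reduction by [q^2 = 16 q - 16] makes the values of [Q] linear in [q], so the bounds on [q] decide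
   the five signs. *)
have QE (x : R) : Q.[x] = x ^+ 4 + (2%:R - q) * x ^+ 3 + (4%:R - 6%:R * q) * x ^+ 2
    + (36%:R * q - 40%:R) * x + (120%:R * q - 128%:R).
  have e : q ^+ 2 = 16%:R * q - 16%:R by lra.
  have -> : 36%:R * q - 40%:R = 3%:R * q ^+ 2 - 12%:R * q + 8%:R by rewrite e; ring.
  have -> : 120%:R * q - 128%:R = (3%:R * q - 4%:R) ^+ 2.
    have -> : (3%:R * q - 4%:R) ^+ 2 = 9%:R * q ^+ 2 - 24%:R * q + 16%:R by ring.
    by rewrite e; ring.
  by rewrite /Q !hornerE.
have szQ : (size Q <= 5)%N.
  apply/leq_sizeP => j j5; rewrite /Q !coefD !coefZ !coefXn coefX coefC.
  by do 5 (case: j j5 => [|j] // j5); rewrite /= !mulr0 !addr0.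
have z0 : z != 0.
  apply: contra_eqN N0 => /eqP->; rewrite !expr0n !mulr0 subrr add0r sub0r.
  by rewrite oppr_eq0 oner_eq0.
pose w := q%:C * z + z^-1.
have qC : q%:C ^+ 2 - 16%:R * q%:C + 16%:R = 0.
  have := congr1 (real_complex R) q2.
  by rewrite !(rmorphD, rmorphN, rmorphM, rmorphXn, rmorph_nat, rmorph0).
have QwE : (map_poly (real_complex R) Q).[w] = w ^+ 4 + (2%:R - q%:C) * w ^+ 3
  + (4%:R - 6%:R * q%:C) * w ^+ 2 + (3%:R * q%:C ^+ 2 - 12%:R * q%:C + 8%:R) * w
  + (3%:R * q%:C - 4%:R) ^+ 2.
  rewrite /Q !rmorphD /= !map_polyZ !map_polyXn map_polyX map_polyC /= !hornerE.
  by rewrite !(rmorphD, rmorphN, rmorphM, rmorphXn, rmorph_nat, rmorphB) /=.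
have fact : (q%:C * z ^+ 2 - 1) * ((q%:C * z ^+ 2 - 2%:R%:C * z + 1) *
    (z ^+ 4 * (map_poly (real_complex R) Q).[w])) = 0.
  rewrite -[RHS]N0 QwE rmorph_nat /w.
  (* The factorisation holds only modulo [q^2 - 16 q + 16]; the added multiple, which is zero, makes
     it an identity in [q] and [z]. *)
  have -> : q%:C ^+ 6 * z ^+ 12 - q%:C ^+ 6 * z ^+ 11 + q%:C * z - 1 =
    q%:C ^+ 6 * z ^+ 12 - q%:C ^+ 6 * z ^+ 11 + q%:C * z - 1 + (q%:C * z ^+ 2 - 1) *
     ((q%:C - 2%:R) * (q%:C ^+ 2 - 16%:R * q%:C + 16%:R) * z ^+ 5).
    by rewrite qC mulr0 mul0r mulr0 addr0.
  by field.
move/eqP: fact; rewrite 3!mulf_eq0 (negPf (expf_neq0 4 z0)) /= => /or3P[]/eqP h.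
- exact: sqr_root_norm h.
- by apply: quad_root_norm h => //; lra.
have Qw : root (map_poly (real_complex R) Q) w by rewrite rootE h.
have [|||||x wx x4] := quartic_roots_real szQ _ _ _ _ _ Qw.
1-5: by rewrite QE; lra.
apply: (@quad_root_norm _ x) => //; first by lra.
by rewrite -wx /w; field.
Qed.

(* The real root between 0 and 1/5 of [q^6 z^12 - q^6 z^11 + q z - 1] is off the circle,
   as [q < 25]. *)
Lemma cos_poly_not_RH (t : R) q : q = 1 + t ^+ 2 -> 14%:R < q -> q < 15%:R ->
  ('i * t%:C) ^+ 4 + 14%:R * ('i * t%:C) ^+ 2 + 1 = 0 ->
  ~ riemann_hypothesis q 12 2 (cos_poly 12 ('i * t%:C)).
Proof.
move=> qt ql qr a4 RH; have q0 : 0 < q by lra.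
have qa : q%:C = 1 - ('i * t%:C) ^+ 2.
  by rewrite exprMn sqr_i mulN1r opprK -rmorphXn -(rmorph1 (real_complex R)) -rmorphD qt.
have a0 := root_neq0 a4.
pose N : {poly R} := q ^+ 6 *: 'X^12 - q ^+ 6 *: 'X^11 + q *: 'X - 1.
have NE (x : R) : N.[x] = q ^+ 6 * x ^+ 12 - q ^+ 6 * x ^+ 11 + q * x - 1 by rewrite /N !hornerE.
have [||x /andP[x0 x5]] := @poly_ivt R N 0 (5%:R^-1); first by lra.
  (* [N] is -1 at 0. At 1/5 the part [q x - 1] exceeds 9/5, while [q^6 (x^11 - x^12)] is at most
     [4 * 15^6 / 5^12], less than 1/5. *)
  rewrite !NE !expr0n !mulr0 subrr add0r sub0r oppr_le0 ler01 /=.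
  have q6 : q ^+ 6 <= 15%:R ^+ 6 by apply: lerXn2r; rewrite ?nnegrE; lra.
  rewrite !exprVn; move: (q ^+ 6) q6 => Q6.
  lra.
rewrite rootE NE => /eqP Nx.
(* This is [1 - 2 x + q x^2]; being nonzero, it leaves [x] as a zero of the zeta polynomial
   itself. *)
have D0 : (1 - x) ^+ 2 + t ^+ 2 * x ^+ 2 != 0.
  by apply: lt0r_neq0; apply: ltr_wpDr; [rewrite mulr_ge0 ?sqr_ge0 | rewrite exprn_gt0; lra].
have := RH x%:C; rewrite (zeta_cos_poly a0 qa) rootE.
have := cos_zeta_horner x%:C a4; rewrite -qa.
have -> : 1 - 2%:R * x%:C + q%:C * x%:C ^+ 2 = ((1 - x) ^+ 2 + t ^+ 2 * x ^+ 2)%:C.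
  rewrite qt !(rmorphD, rmorphN, rmorphM, rmorphXn, rmorph1) /=; ring.
have -> : q%:C ^+ 6 * x%:C ^+ 12 - q%:C ^+ 6 * x%:C ^+ 11 + q%:C * x%:C - 1 = 0 :> C.
  have := congr1 (real_complex R) Nx.
  by rewrite !(rmorphD, rmorphN, rmorphM, rmorphXn, rmorph1, rmorph0).
move/eqP; rewrite mulf_eq0 fmorph_eq0 (negPf D0) /= => Px /(_ Px).
rewrite normc_def /= expr0n addr0 sqrtr_sqr ger0_norm // => -[xq].
have : q * x ^+ 2 = 1 by rewrite xq exprVn sqr_sqrtr ?ltW // mulfV ?lt0r_neq0.
by nra.
Qed.

Lemma cos_poly_extremal a q : 0 < q -> q%:C = 1 - a ^+ 2 ->
  a ^+ 4 + 14%:R * a ^+ 2 + 1 = 0 -> extremal_fwe q 2 12 2 (cos_poly 12 a).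
Proof.
move=> q0 qa a4; split; first exact: cos_poly_fwe.
  exact: cos_poly_divisible.
by move=> d W; apply: fwe12_min_weight qa a4.
Qed.

End CosineEnumerator.

(** * Specialisation to the two square roots of 3 *)

Theorem theorem5p8 (R : realType) :
  let s : R := Num.sqrt 3 in
  (extremal_fwe (8 + 4 * s) 2 12 2 (phi12 s) /\
   ~ riemann_hypothesis (8 + 4 * s) 12 2 (phi12 s)) /\
  (extremal_fwe (8 - 4 * s) 2 12 2 (phi12 (- s)) /\
   riemann_hypothesis (8 - 4 * s) 12 2 (phi12 (- s))).
Proof.
move=> s; have s2 : s ^+ 2 = 3 by rewrite sqr_sqrtr.
have s0 : 0 <= s by rewrite sqrtr_ge0.
(* These bounds put [8 - 4 s] between 1.07 and 1.075, and [8 + 4 s] between 14 and 15. *)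
have sl : 1732%:R / 1000%:R < s by nra.
have sr : s < 17325%:R / 10000%:R by nra.
(* Here [(2 + r)^2 = 7 + 4 r] is a root of [X^2 - 14 X + 1], and [a^2] is its negative. *)
have a4 (r : R) : r ^+ 2 = 3 ->
    ('i%C * (2 + r)%:C%C) ^+ 4 + 14%:R * ('i%C * (2 + r)%:C%C) ^+ 2 + 1 = 0 :> R[i].
  move=> r2; rewrite !exprMn -[4%N]/(2 * 2)%N !exprM sqr_i sqrrN expr1n mul1r mulN1r mulrN.
  have t2 : (2 + r) ^+ 2 = 7%:R + 4%:R * r.
    by have -> : (2 + r) ^+ 2 = 4%:R + 4%:R * r + r ^+ 2 by [ring]; rewrite r2; ring.
  have t4 : (7%:R + 4%:R * r) ^+ 2 = 97%:R + 56%:R * r.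
    have -> : (7%:R + 4%:R * r) ^+ 2 = 49%:R + 56%:R * r + 16%:R * r ^+ 2 by ring.
    by rewrite r2; ring.
  rewrite -!rmorphXn t2 t4 /= !(rmorphD, rmorphM, rmorph_nat) /=; ring.
have qE (r : R) : r ^+ 2 = 3 -> 8 + 4 * r = 1 + (2 + r) ^+ 2.
  by move=> r2; have -> : 1 + (2 + r) ^+ 2 = 5 + 4 * r + r ^+ 2 by [ring]; rewrite r2; ring.
have qa (r : R) : r ^+ 2 = 3 -> (8 + 4 * r)%:C%C = 1 - ('i%C * (2 + r)%:C%C) ^+ 2 :> R[i].
  move=> r2; rewrite (qE _ r2) exprMn sqr_i mulN1r opprK rmorphD rmorphXn /=.
  by rewrite rmorph1.
have sN2 : (- s) ^+ 2 = 3 by rewrite sqrrN.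
(* The lower sign is the case [r = - s] of the facts above. *)
have -> : 8 - 4 * s = 8 + 4 * - s by rewrite mulrN.
rewrite !phi12E //; split; split.
- by apply: cos_poly_extremal; [lra | exact: qa | exact: a4].
- by apply: cos_poly_not_RH; [exact: qE | lra | lra | exact: a4].
- by apply: cos_poly_extremal; [lra | exact: qa | exact: a4].
- apply: cos_poly_RH; [exact: qE | | lra | lra | exact: a4].
  have -> : (8 + 4 * - s) ^+ 2 = 64 - 64 * s + 16 * s ^+ 2 by ring.
  by rewrite s2; ring.
Qed.
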